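(* Let $\gamma>0$. For every $x\in\mathbb R^n$ and every $T>0$, $$V_\gamma(x)=\sup_{\lambda\in\Lambda}\inf_{\mathrm u\in\mathbb U}\min\Bigl\{\min_{t\in[0,T]}\max\bigl[e^{-\gamma t}\ell(\xi(t)),\ \max_{s\in[0,t]}e^{-\gamma s}c(\xi(s))\bigr],\ \max\bigl[e^{-\gamma T}V_\gamma(\xi(T)),\ \max_{t\in[0,T]}e^{-\gamma t}c(\xi(t))\bigr]\Bigr\},$$ where $\xi=\xi_x^{\mathrm u,\lambda[\mathrm u]}$.
   Context: Consider the system $\dot x(t)=f(x(t),\mathrm u(t),\mathrm d(t))$ for $t\ge 0$, $x(0)=x$, where $U\subset\mathbb R^{m_u}$ and $D\subset\mathbb R^{m_d}$ are compact convex sets and $f:\mathbb R^n\times U\times D\to\mathbb R^n$ is uniformly continuous, bounded, and Lipschitz continuous in $x$ uniformly in $(u,d)$ (time-invariant). Let $\mathbb U$ (resp. $\mathbb D$) be the set of Lebesgue measurable maps $[0,\infty)\to U$ (resp. $[0,\infty)\to D$). Let $\Lambda$ be the set of non-anticipative strategies $\lambda:\mathbb U\to\mathbb D$, i.e. for every $t\ge0$, if $\mathrm u(s)=\mathrm u'(s)$ for a.e. $s\in[0,t]$ then $\lambda[\mathrm u](s)=\lambda[\mathrm u'](s)$ for a.e. $s\in[0,t]$. For $x\in\mathbb R^n$, $\mathrm u\in\mathbb U$, $\mathrm d\in\mathbb D$, $\xi_x^{\mathrm u,\mathrm d}(\cdot)$ denotes the unique solution of the system; inside $\sup_\lambda\inf_{\mathrm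 u}$ expressions, $\xi(\cdot)$ abbreviates $\xi_x^{\mathrm u,\lambda[\mathrm u]}(\cdot)$. Let $\ell,c:\mathbb R^n\to\mathbb R$ be bounded and Lipschitz continuous. For $\gamma>0$ define the discounted reach-avoid value function $$V_\gamma(x):=\sup_{\lambda\in\Lambda}\inf_{\mathrm u\in\mathbb U}\inf_{t\in[0,\infty)}\max\Bigl\{e^{-\gamma t}\ell(\xi(t)),\ \max_{s\in[0,t]}e^{-\gamma s}c(\xi(s))\Bigr\}.$$ *)

(* Defs.v *)
(* R : realType, R^n = 'rV[R]_n (sup norm). *)
From mathcomp Require Import all_boot all_order all_algebra.
From mathcomp Require Import all_classical all_reals all_analysis.
Import Order.TTheory GRing.Theory Num.Theory numFieldNormedType.Exports.

Set Implicit Arguments.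
Unset Strict Implicit.
Unset Printing Implicit Defensive.

Local Open Scope ring_scope.
Local Open Scope classical_set_scope.

(* The real line equipped with the Lebesgue (= completed, Caratheodory)
   sigma-algebra; its measure is completed_lebesgue_measure. *)
Definition LebR (R : realType) := caratheodory_type ((wlength (R:=R) idfun)^*)%mu.

Notation leb := (@completed_lebesgue_measure _).

(* convexity of a subset of R^m *)
Definition convex_rV (R : realType) (m : nat) (A : set 'rV[R]_m) : Prop :=
  forall a b, A a -> A b -> forall t : R, 0 <= t <= 1 -> A (t *: a + (1 - t) *: b).

(* Admissible controls: Lebesgue measurable maps [0,oo) -> A
   (represented as maps R -> R^m; values at negative times are irrelevant). *)
Definition admissible (R : realType) (m : nat) (A : set 'rV[R]_m)
    (u : R -> 'rV[R]_m) : Prop :=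
  (forall t, 0 <= t -> A (u t)) /\
  (forall i : 'I_m,
     measurable_fun (`[0, +oo[ : set (LebR R)) ((fun t => u t 0 i) : LebR R -> R)).

(* Non-anticipative strategies lambda : UU -> DD *)
Definition nonanticipative_strategy (R : realType) (mu md : nat)
    (U : set 'rV[R]_mu) (D : set 'rV[R]_md)
    (lam : (R -> 'rV[R]_mu) -> (R -> 'rV[R]_md)) : Prop :=
  (forall u, admissible U u -> admissible D (lam u)) /\
  (forall u u', admissible U u -> admissible U u' -> forall t : R, 0 <= t ->
     {ae leb, forall s : LebR R, `[0, t] s -> u s = u' s} ->
     {ae leb, forall s : LebR R, `[0, t] s -> lam u s = lam u' s}).

(* xi is a (Caratheodory) solution on [0,oo) of xi' = f(xi,u,d), xi(0) = x *)
Definition is_solution (R : realType) (n mu md : nat)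
    (f : 'rV[R]_n -> 'rV[R]_mu -> 'rV[R]_md -> 'rV[R]_n)
    (x : 'rV[R]_n) (u : R -> 'rV[R]_mu) (d : R -> 'rV[R]_md)
    (xi : R -> 'rV[R]_n) : Prop :=
  xi 0 = x /\ {within `[0, +oo[, continuous xi} /\
  forall t : R, 0 <= t -> forall i : 'I_n,
    xi t 0 i = x 0 i + Rintegral leb (`[0, t] : set (LebR R))
                         (fun s => f (xi s) (u s) (d s) 0 i).

(* The (unique, under the standing assumptions) solution xi_x^{u,d}. *)
Definition traj (R : realType) (n mu md : nat)
    (f : 'rV[R]_n -> 'rV[R]_mu -> 'rV[R]_md -> 'rV[R]_n)
    (x : 'rV[R]_n) (u : R -> 'rV[R]_mu) (d : R -> 'rV[R]_md) : R -> 'rV[R]_n :=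
  match pselect (exists xi, is_solution f x u d xi) with
  | left h => proj1_sig (cid h)
  | right _ => fun _ => x
  end.

(* max_{s in [0,t]} e^{-gamma s} c(xi(s)) *)
Definition run_max (R : realType) (n : nat) (gamma : R) (c : 'rV[R]_n -> R)
    (xi : R -> 'rV[R]_n) (t : R) : R :=
  sup [set expR (- (gamma * s)) * c (xi s) | s in `[0, t]].

(* max{ e^{-gamma t} l(xi t), max_{s in [0,t]} e^{-gamma s} c(xi s) } *)
Definition ra_cost (R : realType) (n : nat) (gamma : R) (l c : 'rV[R]_n -> R)
    (xi : R -> 'rV[R]_n) (t : R) : R :=
  Num.max (expR (- (gamma * t)) * l (xi t)) (run_max gamma c xi t).

(* discounted reach-avoid value function V_gamma *)
Definition V_gamma (R : realType) (n mu md : nat)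
    (f : 'rV[R]_n -> 'rV[R]_mu -> 'rV[R]_md -> 'rV[R]_n)
    (U : set 'rV[R]_mu) (D : set 'rV[R]_md) (l c : 'rV[R]_n -> R)
    (gamma : R) (x : 'rV[R]_n) : R :=
  sup [set inf [set inf [set ra_cost gamma l c (traj f x u (lam u)) t
                        | t in `[0, +oo[]
               | u in admissible U]
       | lam in nonanticipative_strategy U D].

(* Main.v *)
(** Caratheodory solutions exist, are unique and depend only on the controls up
    to null sets (Picard iteration in an exponentially weighted sup norm), so a
    trajectory restarted at time [T] is the trajectory of the shifted controls.
    Hence the cost of a trajectory is its cost on [[0, T]] combined with the
    discounted cost of its tail.

    For [<=], a strategy [lam] and a control [u] on [[0, T]] induce the strategy
    [v |-> lam (u then v)] for the tail, which guarantees at most [V (xi T)].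
    For [>=], follow [lam] up to [T] and then an [e]-optimal strategy chosen for
    the state [xi T]; no measurable selection is needed, since each control
    leads to a single state [xi T]. *)

From HB Require Import structures.
Require Import Defs.
From mathcomp Require Import all_boot all_order all_algebra.
From mathcomp Require Import all_classical all_reals all_analysis.
From mathcomp Require Import measurable_realfun ring lra.
Import Order.TTheory GRing.Theory Num.Theory numFieldNormedType.Exports.

Set Implicit Arguments.
Unset Strict Implicit.
Unset Printing Implicit Defensive.

Local Open Scope ring_scope.
Local Open Scope classical_set_scope.

(** * Completed Lebesgue measure and integral *)

Section completed_lebesgue_measure.
Context {R : realType}.
Implicit Types (a : R) (A : set (LebR R)) (g : R -> R).

Let shiftL a : LebR R -> LebR R := shift a.

Lemma leb_shift_le a A : (leb (shiftL a @^-1` A) <= leb A)%E.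
Proof.
have preimage_ocitv (b : R * R) :
    shift a @^-1` `]b.1, b.2]%classic = `]b.1 - a, b.2 - a]%classic.
  by apply/seteqP; split=> x /=; rewrite !in_itv/= ltrBlDr lerBrDr.
have wlength_ocitv (x y : R) : wlength idfun (`]x - a, y - a]%classic : set R) =
    wlength idfun (`]x, y]%classic : set R).
  rewrite !wlength_itv/= !lte_fin ltrD2r; case: ifPn => // _.
  by rewrite -!EFinB; congr (_%:E); ring.
apply: le_ereal_inf_tmp => _ [F [mF AF] <-].
apply: ereal_inf_lbound; exists (fun k => shift a @^-1` F k); first split.
- by move=> k; case: (mF k) => b _ <-; rewrite preimage_ocitv; exact: is_ocitv.
- by move=> x /AF[k _ Fk]; exists k.
- apply: eq_eseriesr => k _; case: (mF k) => b _ <-; rewrite preimage_ocitv.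
  exact: wlength_ocitv.
Qed.

Lemma leb_shift a A : leb (shiftL a @^-1` A) = leb A.
Proof.
apply/eqP; rewrite eq_le leb_shift_le/=.
have := leb_shift_le (- a) (shiftL a @^-1` A).
by rewrite -comp_preimage (comp_shiftK a id : shiftL a \o shiftL (- a) = id).
Qed.

Lemma measurable_LebRP A : measurable A <->
  forall X : set (LebR R), leb X = (leb (X `&` A) + leb (X `&` ~` A))%E.
Proof. by split=> mA; exact: mA. Qed.

Lemma measurable_shift a : measurable_fun [set: LebR R] (shiftL a).
Proof.
move=> _ A /measurable_LebRP mA; rewrite setTI; apply/measurable_LebRP => X.
rewrite -(leb_shift (- a) X) mA -(leb_shift a (_ `&` A)).
rewrite -(leb_shift a (_ `&` ~` A)) !preimage_setI -comp_preimage.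
by rewrite (comp_centerK a id : shiftL (- a) \o shiftL a = id).
Qed.

Lemma pushforward_leb_shift a : pushforward leb (shiftL a) = leb.
Proof. by apply/funext => A; exact: leb_shift. Qed.

Lemma ae_shift a (P : LebR R -> Prop) :
  {ae leb, forall x, P x} -> {ae leb, forall x, P (shiftL a x)}.
Proof.
move=> [A [mA A0 PA]]; exists (shiftL a @^-1` A); split.
- by rewrite -[X in measurable X]setTI; exact: measurable_shift.
- by rewrite leb_shift.
- by move=> x /= Px; exact: PA.
Qed.

Lemma ae_neq a : {ae leb, forall s : LebR R, s <> a}.
Proof.
exists ([set a] : set (LebR R)); split.
- by apply: sub_caratheodory; exact: measurable_set1.
- exact: lebesgue_measure_set1.
- by move=> s /= /contrapT.
Qed.

Lemma measurable_itv_LebR (i : interval R) : measurable ([set` i] : set (LebR R)).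
Proof. by apply: sub_caratheodory; exact: measurable_itv. Qed.

Lemma measurable_fun_LebR (A : set R) g : measurable A ->
  measurable_fun A g -> measurable_fun (A : set (LebR R)) (g : LebR R -> R).
Proof. by move=> mA mg _ B mB; apply: sub_caratheodory; exact: mg. Qed.

Lemma Rintegral_leb (A : set R) g : measurable A -> measurable_fun setT g ->
  leb.-integrable (A : set (LebR R)) (EFin \o g) ->
  Rintegral leb (A : set (LebR R)) g = Rintegral lebesgue_measure A g.
Proof.
move=> mA mg ig; congr fine; pose idL (x : LebR R) : measurableTypeR R := x.
have midL : measurable_fun [set: LebR R] idL.
  by move=> _ B mB; rewrite setTI; exact: sub_caratheodory.
transitivity (\int[pushforward leb idL]_(x in A) (EFin \o g) x)%E.
  apply/esym/integral_pushforward => //; exact/measurable_EFinP.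
by rewrite (_ : pushforward leb idL = lebesgue_measure)//; apply/funext.
Qed.

End completed_lebesgue_measure.

Section interval_integral.
Context {R : realType}.
Implicit Types (g : R -> R) (a b s t K : R).

Lemma integrable_itv_bounded g a b M :
  measurable_fun (`[a, b] : set (LebR R)) (g : LebR R -> R) ->
  (forall s, a <= s <= b -> `|g s| <= M) ->
  leb.-integrable (`[a, b] : set (LebR R)) (EFin \o g).
Proof.
move=> mg gM; apply: measurable_bounded_integrable => //.
- exact: measurable_itv_LebR.
- rewrite [X in (X < _)%E]lebesgue_measure_itv/=.
  by case: ifP => // _; rewrite -EFinB ltry.
- exists M; split; first exact: num_real.
  by move=> r Mr s /=; rewrite in_itv/= => /gM /le_trans; apply; exact: ltW.
Qed.

Lemma Rintegral_itv1 g a : Rintegral leb (`[a, a] : set (LebR R)) g = 0.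
Proof.
rewrite /Rintegral null_set_integral//.
- exact: measurable_itv_LebR.
- rewrite set_itv1; exact: measurable_fun_set1.
- by rewrite set_itv1; exact: lebesgue_measure_set1.
Qed.

Lemma Rintegral_itv_cat g a s t : a <= s <= t ->
  leb.-integrable (`[a, t] : set (LebR R)) (EFin \o g) ->
  Rintegral leb (`[a, t] : set (LebR R)) g =
  Rintegral leb (`[a, s] : set (LebR R)) g + Rintegral leb (`]s, t] : set (LebR R)) g.
Proof.
move=> /andP[as_ st] ig.
have itvU : `[a, t]%classic = `[a, s] `|` `]s, t].
  by rewrite (@itv_bndbnd_setU _ _ _ (BRight s)).
rewrite itvU Rintegral_setU//.
- exact: measurable_itv_LebR.
- exact: measurable_itv_LebR.
- by rewrite -itvU.
- apply/disj_set2P; rewrite -subset0 => x /= []; rewrite !in_itv/=.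
  by move=> /andP[_ xs] /andP[/lt_le_trans/(_ xs)]; rewrite ltxx.
Qed.

Lemma Rintegral_leb_shift (A : set (LebR R)) g a : measurable A ->
  measurable_fun A (g : LebR R -> R) ->
  Rintegral leb (shift a @^-1` A : set (LebR R)) (g \o shift a) = Rintegral leb A g.
Proof.
move=> mA /measurable_EFinP mg; congr fine.
have ge0_shift (h : LebR R -> \bar R) :
    measurable_fun A h -> (forall x, (0 <= h x)%E) ->
    (\int[leb]_(x in shift a @^-1` A) h (shift a x) = \int[leb]_(x in A) h x)%E.
  move=> mh h0; rewrite -[in RHS](pushforward_leb_shift a).
  by rewrite (ge0_integral_pushforward (measurable_shift a)).
rewrite integralE (funepos_comp (EFin \o g)) (funeneg_comp (EFin \o g)).
rewrite [RHS]integralE -(ge0_shift _ (measurable_funepos mg))//.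
by rewrite -(ge0_shift _ (measurable_funeneg mg)).
Qed.

Lemma continuous_expRM K : continuous (fun s => expR (K * s)).
Proof.
move=> s; apply: continuous_comp; last exact: continuous_expR.
exact: mulrl_continuous.
Qed.

Lemma integrable_expR K t : leb.-integrable (`[0, t] : set (LebR R))
  (EFin \o (fun s => K * expR (K * s))).
Proof.
apply: (@integrable_itv_bounded _ _ _ (`|K| * expR (`|K| * t))).
  apply: measurable_fun_LebR => //; apply: measurable_funTS.
  by apply: continuous_measurable_fun => s; apply: cvgMr; exact: continuous_expRM.
move=> s /andP[s0 st]; rewrite normrM (ger0_norm (expR_ge0 _)) ler_wpM2l// ler_expR.
by apply: le_trans (ler_norm _) _; rewrite normrM (ger0_norm s0) ler_wpM2l.
Qed.

Lemma Rintegral_leb_expR K t : 0 <= t ->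
  Rintegral leb (`[0, t] : set (LebR R)) (fun s => K * expR (K * s)) = expR (K * t) - 1.
Proof.
rewrite le_eqVlt => /predU1P[<-|t0].
  by rewrite Rintegral_itv1 mulr0 expR0 subrr.
have cKe : continuous (fun s => K * expR (K * s)).
  by move=> s; apply: cvgMr; exact: continuous_expRM.
rewrite Rintegral_leb//; [|exact: continuous_measurable_fun|exact: integrable_expR].
rewrite /Rintegral (@continuous_FTC2 _ _ (fun s => expR (K * s)))//.
- by rewrite mulr0 expR0.
- exact: continuous_subspaceT.
- split; first by move=> z _; exact: ex_derive.
  + by apply/cvg_at_right_filter; exact: continuous_expRM.
  + by apply/cvg_at_left_filter; exact: continuous_expRM.
- by move=> x _; rewrite derive1E derive_val /GRing.scale/= mulr1 mulrC.
Qed.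

End interval_integral.

(** * Norms, limits and measurability of row vectors *)

(* Makes matrices a [completeNormedModType]. *)
HB.instance Definition _ (R : realType) (m n : nat) := NormedModule.on 'M[R]_(m, n).

Section rV_norm.
Context {R : realType} {n : nat}.
Implicit Types v : 'rV[R]_n.

Lemma rV_norm_leP v r : 0 <= r -> reflect (forall i, `|v 0 i| <= r) (`|v| <= r).
Proof.
move=> r0; rewrite [leLHS]/Num.norm/= mx_normrE.
apply: (iffP (bigmax_leP _ _ _ _)) => [[_ vr] i|vr]; first exact: (vr (0, i)).
by split=> // -[i j] _; rewrite ord1.
Qed.

Lemma coord_norm_le v i : `|v 0 i| <= `|v|.
Proof. by apply/rV_norm_leP. Qed.

End rV_norm.

Lemma lsubmx_norm_le {R : realType} {m n : nat} (v : 'rV[R]_(m + n)) :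
  `|lsubmx v| <= `|v|.
Proof. by apply/rV_norm_leP => // i; rewrite mxE; exact: coord_norm_le. Qed.

Lemma rsubmx_norm_le {R : realType} {m n : nat} (v : 'rV[R]_(m + n)) :
  `|rsubmx v| <= `|v|.
Proof. by apply/rV_norm_leP => // i; rewrite mxE; exact: coord_norm_le. Qed.

Lemma cvg_half_expn {R : realType} (C : R) : C / 2 ^+ k @[k --> \oo] --> (0 : R).
Proof.
under eq_fun do rewrite -exprVn.
by apply: cvg_geometric; rewrite ger0_norm// invf_lt1// ltr1n.
Qed.

Lemma ler_add_half_expn {R : realType} (y b C : R) :
  (forall k, y <= b + C / 2 ^+ k) -> y <= b.
Proof.
move=> yb; have : b + C / 2 ^+ k @[k --> \oo] --> b + 0.
  by apply: cvgD; [exact: cvg_cst|exact: cvg_half_expn].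
by rewrite addr0 => /cvgr_to_ge; apply; exact: nearW.
Qed.

Lemma lipschitz_within_continuous {R : realType} {V W : normedModType R} (k : R)
    (A : set W) (f : W -> V) :
  k.-lipschitz_A f -> {within A, continuous f}.
Proof.
move=> lf; apply/subspace_continuousP => x Ax; apply/cvgrPdist_le => e e0.
have k0 : 0 < `|k| + 1 by rewrite ltr_wpDl.
near=> y.
have Ay : A y by near: y; exact: withinT.
apply: le_trans (lf (x, y) (conj Ax Ay)) _ => /=.
apply: (@le_trans _ _ ((`|k| + 1) * `|x - y|)).
  by rewrite ler_wpM2r// (le_trans (ler_norm _))// lerDl.
rewrite -ler_pdivlMl//; near: y; apply: cvg_within.
by apply: cvgr_dist_le; [exact: cvg_id|rewrite mulr_gt0// invr_gt0].
Unshelve. all: by end_near. Qed.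

Lemma dist_limn_telescope {R : realType} {V : completeNormedModType R}
    (a : nat -> V) (r : nat -> R) : r @ \oo --> 0 ->
  (forall k, `|a k.+1 - a k| <= r k - r k.+1) ->
  forall k, `|a k - limn a| <= r k.
Proof.
move=> r0 step.
have r_ge0 k : 0 <= r k.
  have noninc_r : nonincreasing_seq r.
    by apply/nonincreasing_seqP => j; rewrite -subr_ge0 (le_trans _ (step j)).
  rewrite -(cvg_lim (@Rhausdorff R) r0).
  by apply: nonincreasing_cvgn_ge noninc_r _ k; apply/cvg_ex; exists 0.
have dist k m : `|a k - a (k + m)%N| <= r k - r (k + m)%N.
  elim: m => [|m IH]; first by rewrite addn0 !subrr normr0.
  have := step (k + m)%N; rewrite distrC addnS.
  have := ler_distD (a (k + m)%N) (a k) (a (k + m).+1); lra.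
have close k : \forall m \near \oo, `|a k - a m| <= r k.
  near=> m; have /subnKC <- : (k <= m)%N by near: m; exact: nbhs_infty_ge.
  by apply: le_trans (dist _ _) _; rewrite gerBl.
have ca : cvgn a.
  apply/cauchy_cvgP/cauchy_exP => e e0.
  have [k _ /(_ k (leqnn k)) ke] := cvgr_lt _ r0 _ e0.
  exists (a k); near=> m; rewrite -ball_normE /=.
  by apply: le_lt_trans ke; near: m; exact: close.
move=> k; apply: (@cvgr_to_le _ _ _ _ (fun m => `|a k - a m|)) (close k).
by apply: cvg_norm; apply: cvgB; [exact: cvg_cst|exact: ca].
Unshelve. all: by end_near. Qed.

Section measurable_rV.
Context d (T : measurableType d) {R : realType} (E : set T).
Hypothesis mE : measurable E.

Definition measurable_rV n (g : T -> 'rV[R]_n) :=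
  forall i, measurable_fun E (fun s => g s 0 i).

Lemma measurable_rV_row_mx m n (g : T -> 'rV[R]_m) (h : T -> 'rV[R]_n) :
  measurable_rV g -> measurable_rV h -> measurable_rV (fun s => row_mx (g s) (h s)).
Proof.
move=> mg mh i; case: (split_ordP i) => j ->.
  by under eq_fun do rewrite row_mxEl; exact: mg.
by under eq_fun do rewrite row_mxEr; exact: mh.
Qed.

Lemma rat_ball_exists n (v : 'rV[R]_n) e : 0 < e ->
  exists q : 'rV[rat]_n, ball (map_mx ratr q : 'rV[R]_n) e v.
Proof.
move=> e0; have approx i : exists q : rat, ball (ratr q : R) e (v 0 i).
  have [|q] := @rat_in_itvoo R (v 0 i - e) (v 0 i + e).
    by rewrite ltrBlDr -addrA ltrDl addr_gt0.
  by rewrite in_itv/= => ab; exists q; rewrite /ball/= ltr_distl.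
have [q qv] := choice approx.
by exists (\row_i q i); split=> // i j; rewrite ord1 !mxE.
Qed.

Lemma measurable_rV_ball n (g : T -> 'rV[R]_n) v e : 0 < e -> measurable_rV g ->
  measurable (E `&` g @^-1` ball v e).
Proof.
move=> e0 mg.
rewrite (_ : _ `&` _ = \bigcap_(i in [set: 'I_n])
    (E `&` (fun s => g s 0 i) @^-1` ball (v 0 i) e) `&` E); last first.
  apply/seteqP; split=> s /=.
    by move=> [Es [_ vg]]; split=> // i _; split=> //; exact: vg.
  by move=> [vg Es]; split=> //; split=> // i j; rewrite ord1; case: (vg j).
apply: measurableI => //; apply: fin_bigcap_measurable; first exact: finite_finset.
by move=> i _; apply: mg => //; exact: measurable_ball.
Qed.

(* [O] is the union of the rational balls it contains. *)
Lemma measurable_rV_open n (g : T -> 'rV[R]_n) (O : set 'rV[R]_n) : open O ->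
  measurable_rV g -> measurable (E `&` g @^-1` O).
Proof.
move=> oO mg; pose rball (j : nat * 'rV[rat]_n) : set 'rV[R]_n :=
  ball (map_mx ratr j.2 : 'rV[R]_n) j.1.+1%:R^-1.
have -> : E `&` g @^-1` O =
    \bigcup_(j in [set j | rball j `<=` O]) (E `&` g @^-1` rball j).
  apply/seteqP; split=> [s [Es Os]|s [j jO [Es js]]]; last by split=> //; exact: jO.
  have /nbhs_ballP[_ /posnumP[e] eO] : nbhs (g s) O by exact: open_nbhs_nbhs.
  have [k _ /(_ k (leqnn k))/= /ltW ke] := near_infty_natSinv_lt (e%:num / 2)%:pos.
  have [|q qg] := @rat_ball_exists _ (g s) k.+1%:R^-1; first by rewrite invr_gt0.
  exists (k, q) => // v qv; apply: eO.
  by apply: (@ball_splitr _ _ (map_mx ratr q : 'rV[R]_n)); exact: le_ball ke _ _.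
rewrite bigcup_mkcond; apply: countable_bigcupT_measurable; first exact: countableP.
by move=> j; case: ifP => // _; apply: measurable_rV_ball => //; rewrite invr_gt0.
Qed.

Lemma measurable_within_continuous_comp n (g : T -> 'rV[R]_n) (A : set 'rV[R]_n)
    (h : 'rV[R]_n -> R) :
  measurable_rV g -> (forall s, E s -> A (g s)) -> {within A, continuous h} ->
  measurable_fun E (h \o g).
Proof.
move=> mg gA /continuousP ch; apply: (measurability _ (RGenOInfty.measurableE R)).
move=> _ [_ [a ->] <-].
have /open_subspaceP[W oW WA] : open (h @^-1` `]a, +oo[ : set (subspace A)).
  by apply: ch; exact: interval_open.
rewrite (_ : E `&` _ = E `&` g @^-1` W); first exact: measurable_rV_open.
apply/seteqP; split=> s [Es Ws]; split=> //.
  by have [] : (W `&` A) (g s) by rewrite WA; split=> //; exact: gA.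
by have [] : (h @^-1` `]a, +oo[ `&` A) (g s) by rewrite -WA; split=> //; exact: gA.
Qed.

End measurable_rV.

(** * Functions on the half-line *)

Section half_line.
Context {R : realType}.
Local Notation half_line := (`[0, +oo[%classic : set (LebR R)).

Lemma measurable_rV_shift n (g : R -> 'rV[R]_n) a : 0 <= a ->
  measurable_rV half_line g -> measurable_rV half_line (g \o shift a).
Proof.
move=> a0 mg i.
apply: (measurable_comp (measurable_itv_LebR _) _ (mg i)
  (measurable_funTS (measurable_shift a))).
by move=> _ [x /= + <-]; rewrite !in_itv/= !andbT => x0; exact: addr_ge0.
Qed.

Lemma within_continuous_measurable_rV n (g : R -> 'rV[R]_n) :
  {within `[0, +oo[, continuous g} -> measurable_rV half_line g.
Proof.
move=> cg i; apply: measurable_fun_LebR => //.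
apply: subspace_continuous_measurable_fun => // x.
exact: (cvg_comp g (fun v : 'rV[R]_n => v 0 i) (cg x)
  (@coord_continuous _ _ _ _ _ _)).
Qed.

Definition concat {X : Type} (a : R) (u v : R -> X) s :=
  if s < a then u s else v (s - a).

Lemma concat_shift {X : Type} a (u v : R -> X) s : 0 <= s ->
  (concat a u v \o shift a) s = v s.
Proof. by move=> s0; rewrite /= /concat addrK ltNge lerDr s0. Qed.

Lemma measurable_rV_concat n (g h : R -> 'rV[R]_n) a : 0 <= a ->
  measurable_rV half_line g -> measurable_rV half_line h ->
  measurable_rV half_line (concat a g h).
Proof.
move=> a0 mg mh i.
have -> : half_line = `[0, a[%classic `|` `[a, +oo[%classic.
  by rewrite (@itv_bndbnd_setU _ _ _ (BLeft a)).
apply/measurable_funU; [exact: measurable_itv_LebR..|split].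
- apply: (@eq_measurable_fun _ _ (LebR R) _ _ (fun s => g s 0 i)).
    by move=> s; rewrite inE/= in_itv/= /concat => /andP[_ ->].
  apply: measurable_funS (mg i); first exact: measurable_itv_LebR.
  by move=> s /=; rewrite !in_itv/= andbT => /andP[].
- apply: (@eq_measurable_fun _ _ (LebR R) _ _ (fun s => (h \o shift (- a)) s 0 i)).
    by move=> s; rewrite inE/= in_itv/= andbT /concat ltNge => ->.
  apply: (measurable_comp (measurable_itv_LebR _) _ (mh i)
    (measurable_funTS (measurable_shift (- a)))).
  by move=> _ [x /= + <-]; rewrite !in_itv/= !andbT subr_ge0.
Qed.

Definition ae_eq_upto {X : Type} (t : R) (u v : R -> X) :=
  {ae leb, forall s : LebR R, `[0, t] s -> u s = v s}.

Section ae_eq_upto.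
Context {X : Type}.
Implicit Types (u v : R -> X) (s t a : R).

Lemma ae_eq_uptoW t u v : (forall s, 0 <= s -> u s = v s) -> ae_eq_upto t u v.
Proof. by move=> uv; apply: aeW => s /=; rewrite in_itv/= => /andP[/uv]. Qed.

Lemma ae_eq_upto_lt0 t u v : t < 0 -> ae_eq_upto t u v.
Proof.
move=> t0; apply: aeW => s /=; rewrite in_itv/= => /andP[s0 st].
by have := le_lt_trans (le_trans s0 st) t0; rewrite ltxx.
Qed.

Lemma ae_eq_uptoS s t u v : s <= t -> ae_eq_upto t u v -> ae_eq_upto s u v.
Proof.
move=> st; apply: filterS => r uv /=; rewrite in_itv/= => /andP[r0 rs].
by apply: uv; rewrite /= in_itv/= r0 (le_trans rs).
Qed.

Lemma ae_eq_upto_shift a t u v : 0 <= a ->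
  ae_eq_upto (t + a) u v -> ae_eq_upto t (u \o shift a) (v \o shift a).
Proof.
move=> a0 /(ae_shift a); apply: filterS => s uv /=; rewrite in_itv/= => /andP[s0 st].
by apply: uv; rewrite /= in_itv/= addr_ge0//= lerD2r.
Qed.

Lemma ae_eq_upto_concat a t u u' v v' : ae_eq_upto t u u' ->
  ae_eq_upto (t - a) v v' -> ae_eq_upto t (concat a u v) (concat a u' v').
Proof.
move=> uu' /(ae_shift (- a)); apply: filterS2 uu' => s uu' vv' st.
rewrite /concat; case: ltP => [_|sa]; first exact: uu'.
apply: vv'; move: st; rewrite /= !in_itv/= => /andP[_ st].
by rewrite subr_ge0 sa lerD2r.
Qed.

Lemma ae_eq_upto_concatl a u v : ae_eq_upto a (concat a u v) u.
Proof.
apply: filterS (ae_neq a) => s sa /=; rewrite in_itv/= => /andP[_].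
by rewrite le_eqVlt /concat => /predU1P[//|->].
Qed.

End ae_eq_upto.
End half_line.

Section primitive.
Context {R : realType} {n : nat}.
Implicit Types (g h : R -> 'rV[R]_n) (s t a M : R).

Definition primitive g t : 'rV[R]_n :=
  \row_i Rintegral leb (`[0, t] : set (LebR R)) (fun s => g s 0 i).

Definition locally_integrable_rV g := forall t i,
  leb.-integrable (`[0, t] : set (LebR R)) (EFin \o (fun s => g s 0 i)).

Lemma bounded_locally_integrable_rV g M :
  measurable_rV (`[0, +oo[ : set (LebR R)) g -> (forall s, 0 <= s -> `|g s| <= M) ->
  locally_integrable_rV g.
Proof.
move=> mg gM t i; apply: (@integrable_itv_bounded _ _ _ _ M).
  apply: measurable_funS (mg i); first exact: measurable_itv_LebR.
  by move=> s /=; rewrite !in_itv/= andbT => /andP[].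
by move=> s /andP[s0 _]; apply: le_trans (coord_norm_le _ i) (gM _ s0).
Qed.

Lemma primitive0 g : primitive g 0 = 0.
Proof. by apply/rowP => i; rewrite !mxE Rintegral_itv1. Qed.

Lemma eq_primitive g h t : locally_integrable_rV g -> locally_integrable_rV h ->
  ae_eq_upto t g h -> primitive g t = primitive h t.
Proof.
move=> ig ih gh; apply/rowP => i; rewrite !mxE; congr fine; apply: ae_eq_integral.
- exact: measurable_itv_LebR.
- exact: measurable_int (ig t i).
- exact: measurable_int (ih t i).
- by apply: filterS gh => s gh st /=; rewrite gh.
Qed.

Lemma primitive_dist_le g h (phi : R -> R) t :
  locally_integrable_rV g -> locally_integrable_rV h ->
  leb.-integrable (`[0, t] : set (LebR R)) (EFin \o phi) ->
  (forall s, 0 <= s <= t -> `|g s - h s| <= phi s) ->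
  `|primitive g t - primitive h t| <= Rintegral leb (`[0, t] : set (LebR R)) phi.
Proof.
move=> ig ih iphi ghphi; have mt := @measurable_itv_LebR R `[0, t]%R.
have phi0 s : 0 <= s <= t -> 0 <= phi s by move/ghphi; exact: le_trans.
apply/rV_norm_leP => [|i].
  by apply: Rintegral_ge0 => s /=; rewrite in_itv/= => /phi0.
rewrite !mxE -RintegralB//.
have igh : leb.-integrable (`[0, t] : set (LebR R))
    (EFin \o (fun s => g s 0 i - h s 0 i)).
  exact: (integrableB mt (ig t i) (ih t i)).
apply: le_trans (le_normr_Rintegral mt igh) _; apply: le_Rintegral => //.
  exact: (integrable_norm igh).
move=> s /=; rewrite in_itv/= => /ghphi; apply: le_trans.
by apply: le_trans (coord_norm_le _ i); rewrite !mxE.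
Qed.

Lemma primitive_shift g a t : 0 <= a -> 0 <= t -> locally_integrable_rV g ->
  primitive g (t + a) = primitive g a + primitive (g \o shift a) t.
Proof.
move=> a0 t0 ig; apply/rowP => i; rewrite !mxE.
rewrite (@Rintegral_itv_cat _ _ _ a)//; last by rewrite a0 lerDr.
congr (_ + _).
have iga : leb.-integrable (`[a, t + a] : set (LebR R)) (EFin \o (fun s => g s 0 i)).
  apply: integrableS (ig (t + a) i); [exact: measurable_itv_LebR..|].
  by move=> s /=; rewrite !in_itv/= => /andP[/(le_trans a0)->].
have -> : (`[0, t] : set R) = shift a @^-1` `[a, t + a]%classic.
  by apply/seteqP; split=> s /=; rewrite !in_itv/= lerDr lerD2r.
rewrite (@Rintegral_leb_shift _ _ (fun s => g s 0 i)).
- by rewrite [RHS](@Rintegral_itv_cat _ _ _ a)// ?Rintegral_itv1 ?add0r// lexx lerDr.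
- exact: measurable_itv_LebR.
- exact/measurable_EFinP/(measurable_int _ iga).
Qed.

Lemma primitive_lipschitz g M : locally_integrable_rV g ->
  (forall s, 0 <= s -> `|g s| <= M) -> M.-lipschitz_(`[0, +oo[%classic) (primitive g).
Proof.
move=> ig gM [s t] [/=]; rewrite !in_itv/= !andbT => s0 t0.
have M0 : 0 <= M by exact: le_trans (gM 0 (lexx 0)).
wlog st : s t s0 t0 / s <= t => [wlg|].
  have [/wlg|/ltW /wlg] := leP s t; first exact.
  by rewrite distrC [in `|s - t|]distrC; exact.
apply/rV_norm_leP => [|i]; first exact: mulr_ge0.
have mst := @measurable_itv_LebR R `]s, t]%R.
have igst : leb.-integrable (`]s, t] : set (LebR R)) (EFin \o (fun r => g r 0 i)).
  apply: integrableS (ig t i); [exact: measurable_itv_LebR..|].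
  by move=> r /=; rewrite !in_itv/= => /andP[/ltW/(le_trans s0) ->].
rewrite !mxE [in X in _ - X](@Rintegral_itv_cat _ _ _ s) ?s0//.
rewrite opprD addrA subrr sub0r normrN.
apply: le_trans (le_normr_Rintegral mst igst) _.
have ts : fine (leb (`]s, t] : set (LebR R))) = `|s - t|.
  rewrite [leb _]lebesgue_measure_itv/= lte_fin distrC ger0_norm ?subr_ge0//.
  by case: ltgtP st => //= -> _; rewrite subrr.
rewrite -ts -(Rintegral_cst leb mst); apply: le_Rintegral => //.
- exact: integrable_norm igst.
- apply: integrableS (@integrable_itv_bounded _ (cst M) s t M _ _) => //.
  + exact: measurable_itv_LebR.
  + by move=> r /=; rewrite !in_itv/= => /andP[/ltW -> ->].
  + by move=> r _; rewrite ger0_norm.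
- move=> r /=; rewrite in_itv/= => /andP[/ltW/(le_trans s0) r0 _].
  by apply: le_trans (coord_norm_le _ i) (gM _ r0).
Qed.

End primitive.

(** * Discounted reach-avoid costs *)

Section sup_inf_image.
Context {R : realType} {T : Type}.
Implicit Types (F : T -> R) (P : set T) (b d r y : R).

Lemma le_sup_image F P b t : (forall t, P t -> F t <= b) -> P t ->
  F t <= sup [set F t | t in P].
Proof.
by move=> Fb Pt; apply: ub_le_sup; [exists b => _ [s Ps <-]; exact: Fb|exists t].
Qed.

Lemma sup_image_le F P b : P !=set0 -> (forall t, P t -> F t <= b) ->
  sup [set F t | t in P] <= b.
Proof.
move=> P0 Fb; apply: ge_sup; first exact: image_nonempty.
by move=> _ [s Ps <-]; exact: Fb.
Qed.

Lemma inf_image_le F P b t : (forall t, P t -> b <= F t) -> P t ->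
  inf [set F t | t in P] <= F t.
Proof.
by move=> bF Pt; apply: ge_inf; [exists b => _ [s Ps <-]; exact: bF|exists t].
Qed.

Lemma le_inf_image F P b : P !=set0 -> (forall t, P t -> b <= F t) ->
  b <= inf [set F t | t in P].
Proof.
move=> P0 bF; apply: lb_le_inf; first exact: image_nonempty.
by move=> _ [s Ps <-]; exact: bF.
Qed.

Lemma le_max_scale_inf F P d r y : 0 < d -> P !=set0 ->
  (forall t, P t -> y <= Num.max (d * F t) r) ->
  y <= Num.max (d * inf [set F t | t in P]) r.
Proof.
move=> d0 P0 yF; rewrite le_max; have [_|ry] := leP y r; rewrite ?orbT// orbF.
rewrite -ler_pdivrMl//; apply: le_inf_image => // t /yF.
by rewrite le_max [y <= r]leNgt ry orbF ler_pdivrMl.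
Qed.

End sup_inf_image.

Section itv_from0.
Context {R : realType}.
Implicit Type b : itv_bound R.

Lemma itv0_ge0 b : [set` Interval (BLeft 0) b] `<=` [set t | 0 <= t].
Proof. by move=> t /=; rewrite itv_boundlr => /andP[]. Qed.

Lemma itv0_nonempty b : (BRight 0 <= b)%O -> [set` Interval (BLeft 0) b] !=set0.
Proof. by move=> b0; exists 0; rewrite /= itv_boundlr lexx. Qed.

End itv_from0.

Section discounted_cost.
Context {R : realType} {n : nat} (gamma : R) (l c : 'rV[R]_n -> R) (B : R).
Hypothesis gamma0 : 0 <= gamma.
Hypothesis lB : forall x, `|l x| <= B.
Hypothesis cB : forall x, `|c x| <= B.
Implicit Types (xi eta : R -> 'rV[R]_n) (I : set R) (s t T v : R).

Local Notation disc t := (expR (- (gamma * t))).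

Definition inf_ra_cost I xi : R := inf [set ra_cost gamma l c xi t | t in I].

Definition truncated_cost T xi v : R :=
  Num.min (inf_ra_cost `[0, T] xi) (Num.max (disc T * v) (run_max gamma c xi T)).

Lemma disc_le1 t : 0 <= t -> disc t <= 1.
Proof. by move=> t0; rewrite -expR0 ler_expR oppr_le0 mulr_ge0. Qed.

Lemma discD s t : disc (s + t) = disc t * disc s.
Proof. by rewrite -expRD; congr expR; ring. Qed.

Lemma disc_norm_le v t : 0 <= t -> `|v| <= B -> `|disc t * v| <= B.
Proof.
move=> t0; apply: le_trans; rewrite normrM ger0_norm ?expR_ge0//.
by rewrite ler_piMl// disc_le1.
Qed.

Lemma run_max_ge xi s t : 0 <= s <= t -> disc s * c (xi s) <= run_max gamma c xi t.
Proof.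
move=> st; apply: (@le_sup_image _ _ (fun s => disc s * c (xi s)) _ B).
  move=> r /=; rewrite in_itv/= => /andP[r0 _].
  by apply: ler_normlW; exact: disc_norm_le.
by rewrite /= in_itv.
Qed.

Lemma run_max_le xi t b : 0 <= t ->
  (forall s, 0 <= s <= t -> disc s * c (xi s) <= b) -> run_max gamma c xi t <= b.
Proof.
move=> t0 cb; apply: sup_image_le; first by exists 0; rewrite /= in_itv/= lexx.
by move=> s /=; rewrite in_itv/=; exact: cb.
Qed.

Lemma run_max_norm_le xi t : 0 <= t -> `|run_max gamma c xi t| <= B.
Proof.
move=> t0; rewrite ler_norml; apply/andP; split.
  apply: le_trans (@run_max_ge xi 0 t _); last by rewrite lexx.
  by apply: lerNnormlW; exact: disc_norm_le.
apply: run_max_le => // s /andP[s0 _].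
by apply: ler_normlW; exact: disc_norm_le.
Qed.

Lemma ra_cost_norm_le xi t : 0 <= t -> `|ra_cost gamma l c xi t| <= B.
Proof.
move=> t0; have := run_max_norm_le xi t0; have := disc_norm_le t0 (lB (xi t)).
rewrite !ler_norml /ra_cost ge_max le_max => /andP[_ ->] /andP[-> ->].
by rewrite orbT.
Qed.

Lemma inf_ra_cost_le I xi t : I `<=` [set t | 0 <= t] -> I t ->
  inf_ra_cost I xi <= ra_cost gamma l c xi t.
Proof.
move=> I0 It; apply: (@inf_image_le _ _ _ _ (- B)) => // s /I0 s0.
by apply: lerNnormlW; exact: ra_cost_norm_le.
Qed.

Lemma inf_ra_cost_norm_le I xi : I `<=` [set t | 0 <= t] -> I !=set0 ->
  `|inf_ra_cost I xi| <= B.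
Proof.
move=> I0 In0; have [t It] := In0; rewrite ler_norml; apply/andP; split.
  apply: le_inf_image => // s /I0 s0.
  by apply: lerNnormlW; exact: ra_cost_norm_le.
apply: le_trans (inf_ra_cost_le _ I0 It) _.
by apply: ler_normlW; apply: ra_cost_norm_le; exact: I0.
Qed.

Lemma truncated_cost_norm_le T xi v : 0 <= T -> `|v| <= B ->
  `|truncated_cost T xi v| <= B.
Proof.
move=> T0 vB; have := run_max_norm_le xi T0; have := disc_norm_le T0 vB.
have : `|inf_ra_cost `[0, T] xi| <= B.
  by apply: inf_ra_cost_norm_le _ (@itv0_ge0 _ _) (itv0_nonempty _).
rewrite !ler_norml => /andP[i1 i2] /andP[v1 v2] /andP[m1 m2].
by rewrite /truncated_cost le_min i1 le_max v1 ge_min i2.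
Qed.

Lemma truncated_cost_lerB T xi v v' e : 0 <= T -> 0 <= e -> v - e <= v' ->
  truncated_cost T xi v - e <= truncated_cost T xi v'.
Proof.
move=> T0 e0 vv'; rewrite lerBlDr /truncated_cost.
have dvv' : disc T * v <= disc T * v' + e.
  apply: (@le_trans _ _ (disc T * (v' + e))).
    by rewrite ler_wpM2l ?expR_ge0 -?lerBlDr.
  by rewrite mulrDr lerD2l ler_piMl// disc_le1.
rewrite addr_minl addr_maxl le_min !ge_min lerDl e0/=; apply/orP; right.
by rewrite ge_max !le_max dvv' lerDl e0 orbT.
Qed.

Lemma le_truncated_cost_inf {X : Type} (P : set X) (F : X -> R) T xi b :
  P !=set0 -> (forall x, P x -> b <= truncated_cost T xi (F x)) ->
  b <= truncated_cost T xi (inf [set F x | x in P]).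
Proof.
move=> P0 bF; rewrite le_min; apply/andP; split.
  by have [x /bF] := P0; rewrite le_min => /andP[].
apply: le_max_scale_inf => //; first exact: expR_gt0.
by move=> x /bF; rewrite le_min => /andP[].
Qed.

Lemma eq_run_max xi eta t : (forall s, 0 <= s <= t -> xi s = eta s) ->
  run_max gamma c xi t = run_max gamma c eta t.
Proof.
by move=> xieta; congr sup; apply: eq_imagel => s /=; rewrite in_itv/= => /xieta ->.
Qed.

Lemma eq_ra_cost xi eta t : 0 <= t -> (forall s, 0 <= s <= t -> xi s = eta s) ->
  ra_cost gamma l c xi t = ra_cost gamma l c eta t.
Proof.
by move=> t0 xieta; rewrite /ra_cost (eq_run_max xieta) xieta// t0 lexx.
Qed.

Lemma eq_truncated_cost T xi eta v : 0 <= T ->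
  (forall s, 0 <= s <= T -> xi s = eta s) ->
  truncated_cost T xi v = truncated_cost T eta v.
Proof.
move=> T0 xieta; rewrite /truncated_cost (eq_run_max xieta); congr (Num.min _ _).
congr inf; apply: eq_imagel => t /=; rewrite in_itv/= => /andP[t0 tT].
by apply: eq_ra_cost => // s /andP[s0 st]; rewrite xieta// s0 (le_trans st).
Qed.

Section restart.
Variables (xi eta : R -> 'rV[R]_n) (T : R).
Hypothesis T0 : 0 <= T.
Hypothesis xi_eta : forall s, 0 <= s -> xi (s + T) = eta s.

Lemma run_max_restart t : 0 <= t -> run_max gamma c xi (t + T) =
  Num.max (disc T * run_max gamma c eta t) (run_max gamma c xi T).
Proof.
move=> t0; apply/le_anti/andP; split.
  apply: run_max_le => [|s /andP[s0 st]]; first exact: addr_ge0.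
  rewrite le_max; have [sT|/ltW Ts] := leP s T.
    by rewrite (run_max_ge xi)// ?orbT// s0.
  have sT0 : 0 <= s - T by rewrite subr_ge0.
  rewrite -(subrK T s) discD xi_eta// -mulrA ler_wpM2l ?expR_ge0//.
  by rewrite run_max_ge// sT0 lerBlDr.
rewrite ge_max; apply/andP; split; last first.
  apply: run_max_le => // s /andP[s0 sT]; apply: run_max_ge.
  by rewrite s0 (le_trans sT)// lerDr.
rewrite -ler_pdivlMl ?expR_gt0//; apply: run_max_le => // s /andP[s0 st].
rewrite ler_pdivlMl ?expR_gt0// mulrA -discD -xi_eta//.
by apply: run_max_ge; rewrite addr_ge0//= lerD2r.
Qed.

Lemma ra_cost_restart t : 0 <= t -> ra_cost gamma l c xi (t + T) =
  Num.max (disc T * ra_cost gamma l c eta t) (run_max gamma c xi T).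
Proof.
move=> t0; rewrite /ra_cost run_max_restart// discD xi_eta// -mulrA maxA.
by rewrite maxr_pMr ?expR_ge0.
Qed.

Lemma inf_ra_cost_restart :
  inf_ra_cost `[0, +oo[ xi = truncated_cost T xi (inf_ra_cost `[0, +oo[ eta).
Proof.
have half_line0 : (`[0, +oo[%classic : set R) !=set0 by exact: itv0_nonempty.
apply/le_anti/andP; split.
  apply: le_truncated_cost_inf => // t /itv0_ge0 t0.
  rewrite /truncated_cost -ra_cost_restart// le_min; apply/andP; split.
    apply: le_inf_image => [|s /itv0_ge0 s0]; first exact: itv0_nonempty.
    by apply: inf_ra_cost_le _ (@itv0_ge0 _ _) _; rewrite /= in_itv/= s0.
  by apply: inf_ra_cost_le _ (@itv0_ge0 _ _) _; rewrite /= in_itv/= addr_ge0.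
apply: le_inf_image => // t /itv0_ge0 t0.
rewrite ge_min; have [tT|/ltW Tt] := leP t T.
  by rewrite inf_ra_cost_le//; [exact: itv0_ge0|rewrite /= in_itv/= t0].
have tT0 : 0 <= t - T by rewrite subr_ge0.
apply/orP; right; rewrite -(subrK T t) ra_cost_restart//.
rewrite ge_max !le_max lexx orbT andbT ler_wpM2l ?expR_ge0//.
by apply: inf_ra_cost_le _ (@itv0_ge0 _ _) _; rewrite /= in_itv/= tT0.
Qed.

End restart.
End discounted_cost.

(** * Strategies and trajectories *)

Section admissible.
Context {R : realType} {m : nat} (A : set 'rV[R]_m).
Implicit Types (u v : R -> 'rV[R]_m) (a : R).

Lemma admissible_shift u a : 0 <= a -> admissible A u -> admissible A (u \o shift a).
Proof.
move=> a0 [Au meas_u]; split=> [t t0|]; first by apply: Au; exact: addr_ge0.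
exact: measurable_rV_shift.
Qed.

Lemma admissible_concat u v a : 0 <= a ->
  admissible A u -> admissible A v -> admissible A (concat a u v).
Proof.
move=> a0 [Au meas_u] [Av meas_v]; split=> [t t0|]; last exact: measurable_rV_concat.
rewrite /concat; case: ltP => ta; first exact: Au.
by apply: Av; rewrite subr_ge0.
Qed.

End admissible.

Section upper_value.
Context {R : realType} {mu md : nat} (U : set 'rV[R]_mu) (D : set 'rV[R]_md).
Local Notation control := (R -> 'rV[R]_mu).
Local Notation disturbance := (R -> 'rV[R]_md).
Implicit Types (G : control -> disturbance -> R) (lam : control -> disturbance).
Implicit Types (u : control) (d : disturbance) (B b e : R).

Definition guaranteed_cost G lam : R := inf [set G u (lam u) | u in admissible U].

Definition upper_value G : R :=
  sup [set guaranteed_cost G lam | lam in nonanticipative_strategy U D].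

Lemma eq_upper_value G G' :
  (forall u d, admissible U u -> admissible D d -> G u d = G' u d) ->
  upper_value G = upper_value G'.
Proof.
move=> GG'; congr sup; apply: eq_imagel => lam [lamD _]; congr inf.
by apply: eq_imagel => u au; rewrite GG'//; exact: lamD.
Qed.

Lemma guaranteed_cost_le G lam B u : (forall u d, `|G u d| <= B) -> admissible U u ->
  guaranteed_cost G lam <= G u (lam u).
Proof.
move=> GB au; apply: (@inf_image_le _ _ (fun u => G u (lam u)) _ (- B)) => // v _.
exact: lerNnormlW.
Qed.

Section nonempty.
Variables (u0 : control) (d0 : disturbance) (G : control -> disturbance -> R) (B : R).
Hypotheses (au0 : admissible U u0) (ad0 : admissible D d0).
Hypothesis GB : forall u d, `|G u d| <= B.

Lemma le_guaranteed_cost lam b :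
  (forall u, admissible U u -> b <= G u (lam u)) -> b <= guaranteed_cost G lam.
Proof. by move=> bG; apply: le_inf_image => //; exists u0. Qed.

Lemma guaranteed_cost_norm_le lam : `|guaranteed_cost G lam| <= B.
Proof.
rewrite ler_norml; apply/andP; split.
  by apply: le_guaranteed_cost => u _; exact: lerNnormlW.
by apply: le_trans (guaranteed_cost_le _ GB au0) _; exact: ler_normlW.
Qed.

Lemma le_upper_value lam : nonanticipative_strategy U D lam ->
  guaranteed_cost G lam <= upper_value G.
Proof.
move=> slam; apply: (@le_sup_image _ _ (guaranteed_cost G) _ B) => // lam' _.
exact: ler_normlW (guaranteed_cost_norm_le _).
Qed.

Lemma strategy_nonempty : nonanticipative_strategy U D !=set0.
Proof. by exists (fun=> d0); split=> // u u' _ _ t _ _; exact: aeW. Qed.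

Lemma upper_value_le b :
  (forall lam, nonanticipative_strategy U D lam -> guaranteed_cost G lam <= b) ->
  upper_value G <= b.
Proof. by move=> Gb; apply: sup_image_le => //; exact: strategy_nonempty. Qed.

Lemma upper_value_norm_le : `|upper_value G| <= B.
Proof.
have [lam slam] := strategy_nonempty; rewrite ler_norml; apply/andP; split.
  apply: le_trans (le_upper_value slam).
  exact: lerNnormlW (guaranteed_cost_norm_le _).
apply: upper_value_le => lam' _.
exact: ler_normlW (guaranteed_cost_norm_le _).
Qed.

Lemma upper_value_adherent e : 0 < e ->
  exists2 lam, nonanticipative_strategy U D lam &
    upper_value G - e < guaranteed_cost G lam.
Proof.
move=> e0; have [|_ [lam slam <-] elam] :=
    @sup_adherent _ (guaranteed_cost G @` nonanticipative_strategy U D) _ e0.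
  split; first exact/image_nonempty/strategy_nonempty.
  by exists (upper_value G) => _ [lam slam <-]; exact: le_upper_value.
by exists lam.
Qed.

End nonempty.
End upper_value.

Section reach_avoid_game.
Context {R : realType} {n mu md : nat}.
Variables (U : set 'rV[R]_mu) (D : set 'rV[R]_md).
Variable f : 'rV[R]_n -> 'rV[R]_mu -> 'rV[R]_md -> 'rV[R]_n.
Variables M L : R.
Hypothesis f_ucont : forall e : R, 0 < e -> exists2 delta : R, 0 < delta &
  forall x x' u u' d d', U u -> U u' -> D d -> D d' ->
    `|x - x'| < delta -> `|u - u'| < delta -> `|d - d'| < delta ->
    `|f x u d - f x' u' d'| < e.
Hypothesis f_bounded : forall x u d, U u -> D d -> `|f x u d| <= M.
Hypothesis f_lipschitz : forall x y u d, U u -> D d ->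
  `|f x u d - f y u d| <= L * `|x - y|.

Implicit Types (u : R -> 'rV[R]_mu) (d : R -> 'rV[R]_md) (xi eta : R -> 'rV[R]_n).
Implicit Types (x : 'rV[R]_n) (s t T C : R).
Local Notation half_line_continuous xi := {within `[0, +oo[, continuous xi}.

Definition rhs u d xi s := f (xi s) (u s) (d s).

Definition picard x u d xi t := x + primitive (rhs u d xi) t.

Lemma is_solutionP x u d xi : is_solution f x u d xi <->
  half_line_continuous xi /\ forall t, 0 <= t -> xi t = picard x u d xi t.
Proof.
split=> [[_ [cxi eq_xi]]|[cxi eq_xi]].
  by split=> // t t0; apply/rowP => i; rewrite !mxE eq_xi.
split; first by rewrite eq_xi// /picard primitive0 addr0.
by split=> // t t0 i; rewrite eq_xi// !mxE.
Qed.

Lemma rhs_norm_le u d xi s : admissible U u -> admissible D d -> 0 <= s ->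
  `|rhs u d xi s| <= M.
Proof. by move=> [Uu _] [Dd _] s0; apply: f_bounded; [exact: Uu|exact: Dd]. Qed.

Lemma f_bound_ge0 u d : admissible U u -> admissible D d -> 0 <= M.
Proof. by move=> au ad; exact: le_trans (rhs_norm_le (cst 0) au ad (lexx 0)). Qed.

Lemma f_coord_within_continuous i :
  {within [set v : 'rV[R]_(n + (mu + md)) |
      U (lsubmx (rsubmx v)) /\ D (rsubmx (rsubmx v))],
    continuous (fun v => f (lsubmx v) (lsubmx (rsubmx v)) (rsubmx (rsubmx v)) 0 i)}.
Proof.
apply/subspace_continuousP => v [Uv Dv].
apply/cvgrPdist_lt => e /f_ucont[delta delta0 fd].
near=> w.
have [Uw Dw] : U (lsubmx (rsubmx w)) /\ D (rsubmx (rsubmx w)).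
  by near: w; exact: withinT.
have vw : `|v - w| < delta.
  suff : ball v delta w by rewrite -ball_normE.
  by near: w; apply: cvg_within; exact: nbhsx_ballx.
apply: le_lt_trans (fd _ _ _ _ _ _ Uv Uw Dv Dw _ _ _).
- by apply: le_trans (coord_norm_le _ i); rewrite /from_subspace !mxE.
- by apply: le_lt_trans vw; rewrite -linearB lsubmx_norm_le.
- apply: le_lt_trans vw; rewrite -!linearB.
  exact: le_trans (lsubmx_norm_le _) (rsubmx_norm_le _).
- apply: le_lt_trans vw; rewrite -!linearB.
  exact: le_trans (rsubmx_norm_le _) (rsubmx_norm_le _).
Unshelve. all: by end_near. Qed.

Lemma rhs_integrable u d xi : admissible U u -> admissible D d ->
  half_line_continuous xi -> locally_integrable_rV (rhs u d xi).
Proof.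
move=> au ad cxi; apply: (bounded_locally_integrable_rV (M := M)); last first.
  by move=> s; exact: rhs_norm_le.
have [[Uu meas_u] [Dd meas_d]] := (au, ad).
have mg := measurable_rV_row_mx (within_continuous_measurable_rV cxi)
  (measurable_rV_row_mx meas_u meas_d).
move=> i.
have := measurable_within_continuous_comp _ mg _ (@f_coord_within_continuous i).
rewrite (_ : _ \o _ = fun s => rhs u d xi s 0 i); last first.
  by apply/funext => s /=; rewrite !row_mxKr !row_mxKl.
apply; first exact: measurable_itv_LebR.
move=> s /itv0_ge0 s0; rewrite /= row_mxKr row_mxKl row_mxKr.
by split; [exact: Uu|exact: Dd].
Qed.

Lemma eq_picard x u u' d d' xi t :
  admissible U u -> admissible U u' -> admissible D d -> admissible D d' ->
  half_line_continuous xi -> ae_eq_upto t u u' -> ae_eq_upto t d d' ->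
  picard x u d xi t = picard x u' d' xi t.
Proof.
move=> au au' ad ad' cxi uu' dd'; congr (_ + _).
apply: eq_primitive; [exact: rhs_integrable..|].
by apply: filterS2 uu' dd' => s eq_u eq_d st; rewrite /rhs eq_u// eq_d.
Qed.

Lemma picard_lipschitz x u d xi : admissible U u -> admissible D d ->
  half_line_continuous xi -> M.-lipschitz_(`[0, +oo[%classic) (picard x u d xi).
Proof.
move=> au ad cxi [s t] st; rewrite /picard /= opprD addrACA subrr add0r.
apply: (primitive_lipschitz (rhs_integrable au ad cxi) _ st) => r.
exact: rhs_norm_le.
Qed.

Lemma picard_dist_initial x u d xi t : admissible U u -> admissible D d ->
  half_line_continuous xi -> 0 <= t -> `|picard x u d xi t - x| <= M * t.
Proof.
move=> au ad cxi t0; have lip := @picard_lipschitz x _ _ _ au ad cxi.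
have := lip (t, 0).
rewrite /= subr0 (ger0_norm t0) {2}/picard primitive0 addr0; apply.
by rewrite !in_itv/= !andbT.
Qed.

Let K := 2 * (`|L| + 1).
Local Notation weight t := (expR (K * t)).

Lemma double_le_weight t : 0 <= t -> 2 * t <= weight t.
Proof.
move=> t0; apply: le_trans (expR_ge1Dx _).
have : 0 <= `|L| * t by exact: mulr_ge0.
rewrite /K; lra.
Qed.

(* In the sup norm weighted by [expR (- K * t)], the Picard operator contracts
   by 1/2. *)
Lemma picard_contraction x u d xi eta C t : admissible U u -> admissible D d ->
  half_line_continuous xi -> half_line_continuous eta -> 0 <= t ->
  (forall s, 0 <= s <= t -> `|xi s - eta s| <= C * weight s) ->
  `|picard x u d xi t - picard x u d eta t| <= C / 2 * weight t.
Proof.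
move=> au ad cxi ceta t0 xieta.
have C0 : 0 <= C.
  have := xieta 0; rewrite lexx t0 mulr0 expR0 mulr1 => /(_ isT).
  exact: le_trans.
rewrite /picard opprD addrACA subrr add0r.
have iw := integrableZl (@measurable_itv_LebR R `[0, t]%R) (C / 2)
  (integrable_expR K t).
apply: le_trans (primitive_dist_le (rhs_integrable au ad cxi)
  (rhs_integrable au ad ceta) iw _) _.
  move=> s st; have [s0 _] := andP st.
  have [[Uu _] [Dd _]] := (au, ad).
  apply: le_trans (f_lipschitz _ _ (Uu _ s0) (Dd _ s0)) _.
  have -> : C / 2 * (K * weight s) = (`|L| + 1) * (C * weight s) by rewrite /K; field.
  apply: (@le_trans _ _ ((`|L| + 1) * `|xi s - eta s|)).
    by rewrite ler_wpM2r// (le_trans (ler_norm _))// lerDl.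
  by rewrite ler_wpM2l ?xieta// addr_ge0.
rewrite RintegralZl; [|exact: measurable_itv_LebR|exact: integrable_expR].
by rewrite Rintegral_leb_expR// ler_wpM2l ?divr_ge0// gerBl.
Qed.

Lemma solution_unique x u u' d d' xi eta T :
  admissible U u -> admissible U u' -> admissible D d -> admissible D d' ->
  ae_eq_upto T u u' -> ae_eq_upto T d d' ->
  is_solution f x u d xi -> is_solution f x u' d' eta ->
  forall t, 0 <= t <= T -> xi t = eta t.
Proof.
move=> au au' ad ad' uu' dd' /is_solutionP[cxi eq_xi] /is_solutionP[ceta eq_eta].
have dist k t : 0 <= t <= T -> `|xi t - eta t| <= M / 2 ^+ k * weight t.
  elim: k t => [|k IH] t /andP[t0 tT].
    rewrite expr0 divr1 (le_trans (ler_distD x _ _))// (distrC x) eq_xi// eq_eta//.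
    apply: le_trans (lerD (picard_dist_initial x au ad cxi t0)
      (picard_dist_initial x au' ad' ceta t0)) _.
    rewrite -mulrDr -mulr2n -mulr_natl ler_wpM2l ?double_le_weight//.
    exact: f_bound_ge0 au ad.
  rewrite eq_xi// eq_eta//.
  rewrite -(eq_picard x au au' ad ad' ceta (ae_eq_uptoS tT uu') (ae_eq_uptoS tT dd')).
  rewrite exprSr invfM mulrA; apply: picard_contraction => // s /andP[s0 st].
  by apply: IH; rewrite s0 (le_trans st).
move=> t tT; apply/eqP; rewrite -subr_eq0 -normr_le0.
apply: (@ler_add_half_expn _ _ _ (M * weight t)) => k.
by rewrite add0r mulrAC; exact: dist.
Qed.

Lemma solution_lipschitz x u d xi : admissible U u -> admissible D d ->
  is_solution f x u d xi -> M.-lipschitz_(`[0, +oo[%classic) xi.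
Proof.
move=> au ad /is_solutionP[cxi eq_xi] [s t] /[dup] st [/itv0_ge0 s0 /itv0_ge0 t0].
by rewrite /= !eq_xi//; exact: (@picard_lipschitz x _ _ _ au ad cxi (s, t)).
Qed.

Definition picard_iter x u d k := iter k (picard x u d) (cst x).

Definition picard_limit x u d t : 'rV[R]_n := limn (fun k => picard_iter x u d k t).

Section existence.
Variables (x : 'rV[R]_n) (u : R -> 'rV[R]_mu) (d : R -> 'rV[R]_md).
Hypotheses (au : admissible U u) (ad : admissible D d).
Local Notation X := (picard_iter x u d).

Lemma picard_iter_lipschitz k : M.-lipschitz_(`[0, +oo[%classic) (X k).
Proof.
elim: k => [|k IH].
  move=> [s t] _; rewrite /picard_iter /= subrr normr0 mulr_ge0//.
  exact: f_bound_ge0 au ad.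
by apply: picard_lipschitz => //; exact: lipschitz_within_continuous IH.
Qed.

Lemma picard_iter_continuous k : half_line_continuous (X k).
Proof. by apply: lipschitz_within_continuous; exact: picard_iter_lipschitz. Qed.

Lemma picard_iter_step k t : 0 <= t ->
  `|X k.+1 t - X k t| <= M / 2 ^+ k.+1 * weight t.
Proof.
elim: k t => [|k IH] t t0.
  have := picard_dist_initial x au ad (@picard_iter_continuous 0) t0.
  rewrite /picard_iter /= => /le_trans; apply.
  rewrite expr1 -mulrA ler_wpM2l ?(f_bound_ge0 au ad)// mulrC ler_pdivlMr// mulrC.
  exact: double_le_weight.
rewrite exprSr invfM mulrA; apply: picard_contraction => //.
- exact: (@picard_iter_continuous k.+1).
- exact: picard_iter_continuous.
- by move=> s /andP[s0 _]; exact: IH.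
Qed.

Lemma picard_limit_dist k t : 0 <= t ->
  `|X k t - picard_limit x u d t| <= M / 2 ^+ k * weight t.
Proof.
move=> t0; apply: (dist_limn_telescope (a := X^~ t)
  (r := fun j => M / 2 ^+ j * weight t)) => [|j].
  by under eq_fun do rewrite mulrAC; exact: cvg_half_expn.
apply: le_trans (picard_iter_step j t0) _; rewrite -mulrBl.
have {1}-> : M / 2 ^+ j.+1 = M / 2 ^+ j - M / 2 ^+ j.+1.
  by rewrite exprS; field; rewrite expf_neq0.
by [].
Qed.

Lemma picard_limit_lipschitz : M.-lipschitz_(`[0, +oo[%classic) (picard_limit x u d).
Proof.
move=> [s t] /[dup] st [/itv0_ge0 s0 /itv0_ge0 t0].
apply: (@ler_add_half_expn _ _ _ (M * weight s + M * weight t)) => k.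
have := picard_limit_dist k s0; rewrite distrC => Xs.
have Xst := @picard_iter_lipschitz k (s, t) st.
rewrite mulrDl !(mulrAC M _ (_^-1)) addrCA.
apply: le_trans (ler_distD (X k s) _ _) (lerD Xs _).
by apply: le_trans (ler_distD (X k t) _ _) (lerD Xst _); exact: picard_limit_dist.
Qed.

Lemma picard_limit_continuous : half_line_continuous (picard_limit x u d).
Proof. by apply: lipschitz_within_continuous; exact: picard_limit_lipschitz. Qed.

Lemma solution_exists : exists xi, is_solution f x u d xi.
Proof.
exists (picard_limit x u d); apply/is_solutionP; split.
  exact: picard_limit_continuous.
move=> t t0; apply/eqP; rewrite -subr_eq0 -normr_le0.
apply: (@ler_add_half_expn _ _ _ (M * weight t)) => k; rewrite add0r.
apply: le_trans (ler_distD (X k.+1 t) _ _) _.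
have step := picard_contraction x au ad (@picard_iter_continuous k)
  picard_limit_continuous t0 (fun s s0t => picard_limit_dist k (proj1 (andP s0t))).
have := picard_limit_dist k.+1 t0.
rewrite (distrC (X k.+1 t) (picard_limit x u d t)) => dist.
apply: le_trans (lerD dist step) _.
by rewrite exprSr invfM mulrA -mulrDl -splitr mulrAC.
Qed.

End existence.

Lemma traj_solution x u d : admissible U u -> admissible D d ->
  is_solution f x u d (traj f x u d).
Proof.
move=> au ad; rewrite /traj; case: pselect => [sol|]; first by case: cid.
by case; exact: solution_exists.
Qed.

Lemma eq_traj_upto x u u' d d' T :
  admissible U u -> admissible U u' -> admissible D d -> admissible D d' ->
  ae_eq_upto T u u' -> ae_eq_upto T d d' ->
  forall t, 0 <= t <= T -> traj f x u d t = traj f x u' d' t.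
Proof.
move=> au au' ad ad' uu' dd'.
by apply: solution_unique uu' dd' _ _ => //; exact: traj_solution.
Qed.

Lemma eq_traj x u u' d d' :
  admissible U u -> admissible U u' -> admissible D d -> admissible D d' ->
  (forall s, 0 <= s -> u s = u' s) -> (forall s, 0 <= s -> d s = d' s) ->
  forall t, 0 <= t -> traj f x u d t = traj f x u' d' t.
Proof.
move=> au au' ad ad' uu' dd' t t0.
by apply: (@eq_traj_upto _ _ _ _ _ t); rewrite ?t0 ?lexx//; exact: ae_eq_uptoW.
Qed.

Lemma traj_shift x u d T t : admissible U u -> admissible D d -> 0 <= T -> 0 <= t ->
  traj f x u d (t + T) = traj f (traj f x u d T) (u \o shift T) (d \o shift T) t.
Proof.
move=> au ad T0 t0; have := traj_solution x au ad; set xi := traj f x u d => sol.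
have [cxi eq_xi] := (is_solutionP _ _ _ _).1 sol.
have auT := admissible_shift T0 au; have adT := admissible_shift T0 ad.
apply: (@solution_unique (xi T) _ _ _ _ (xi \o shift T) _ t auT auT adT adT).
- exact: ae_eq_uptoW.
- exact: ae_eq_uptoW.
- apply/is_solutionP; split.
    have lip := solution_lipschitz au ad sol.
    apply: (@lipschitz_within_continuous _ _ _ M) => -[r s].
    move=> [/itv0_ge0 r0 /itv0_ge0 s0]; have := lip (r + T, s + T).
    rewrite /= opprD addrACA subrr addr0; apply.
    by rewrite !in_itv/= !andbT !addr_ge0.
  move=> s s0; rewrite /= eq_xi ?addr_ge0// /picard primitive_shift//; last first.
    exact: rhs_integrable.
  by rewrite addrA; congr (_ + _); exact/esym/eq_xi.
- exact: traj_solution.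
- by rewrite t0 lexx.
Qed.

(** * Dynamic programming *)

Variables (l c : 'rV[R]_n -> R) (gamma B : R).
Hypothesis gamma0 : 0 <= gamma.
Hypothesis lB : forall x, `|l x| <= B.
Hypothesis cB : forall x, `|c x| <= B.
Variables (u0 : R -> 'rV[R]_mu) (d0 : R -> 'rV[R]_md).
Hypotheses (au0 : admissible U u0) (ad0 : admissible D d0).
Variable T : R.
Hypothesis T0 : 0 <= T.

Local Notation control := (R -> 'rV[R]_mu).
Local Notation strategy := (control -> R -> 'rV[R]_md).
Local Notation nonanticipative := (nonanticipative_strategy U D).
Local Notation V := (V_gamma f U D l c gamma).
Implicit Type lam : strategy.

Definition reach_avoid_cost x u d : R :=
  inf_ra_cost gamma l c `[0, +oo[ (traj f x u d).
Local Notation J := reach_avoid_cost.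

Definition truncated_reach_avoid_cost x u d : R :=
  truncated_cost gamma l c T (traj f x u d) (V (traj f x u d T)).
Local Notation JT := truncated_reach_avoid_cost.

Lemma V_gammaE x : V x = upper_value U D (J x).
Proof. by []. Qed.

Lemma reach_avoid_cost_norm_le x u d : `|J x u d| <= B.
Proof.
by apply: inf_ra_cost_norm_le => //; [exact: itv0_ge0|exact: itv0_nonempty].
Qed.

Lemma V_gamma_norm_le x : `|V x| <= B.
Proof. exact: (upper_value_norm_le au0 ad0 (reach_avoid_cost_norm_le x)). Qed.

Lemma truncated_reach_avoid_cost_norm_le x u d : `|JT x u d| <= B.
Proof. by apply: truncated_cost_norm_le => //; exact: V_gamma_norm_le. Qed.

Lemma reach_avoid_cost_restart x u u1 u2 d d1 d2 :
  admissible U u -> admissible U u1 -> admissible U u2 ->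
  admissible D d -> admissible D d1 -> admissible D d2 ->
  ae_eq_upto T u u1 -> ae_eq_upto T d d1 ->
  (forall s, 0 <= s -> (u \o shift T) s = u2 s) ->
  (forall s, 0 <= s -> (d \o shift T) s = d2 s) ->
  J x u d = truncated_cost gamma l c T (traj f x u1 d1) (J (traj f x u1 d1 T) u2 d2).
Proof.
move=> au au1 au2 ad ad1 ad2 uu1 dd1 uu2 dd2.
have eq_traj1 := @eq_traj_upto x _ _ _ _ _ au au1 ad ad1 uu1 dd1.
rewrite -(eq_truncated_cost _ _ _ _ T0 eq_traj1).
apply: inf_ra_cost_restart => // s s0; rewrite traj_shift// eq_traj1 ?T0 ?lexx//.
exact: (eq_traj _ (admissible_shift T0 au) au2 (admissible_shift T0 ad) ad2
  uu2 dd2 s0).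
Qed.

Definition shifted_strategy u lam : strategy :=
  fun v => lam (concat T u v) \o shift T.

Lemma shifted_strategyP u lam : admissible U u -> nonanticipative lam ->
  nonanticipative (shifted_strategy u lam).
Proof.
move=> au [lamD lam_na]; split=> [v av|v v' av av' t t0 vv'].
  by apply: admissible_shift T0 _; apply: lamD; exact: admissible_concat.
apply: ae_eq_upto_shift T0 _.
apply: lam_na; [exact: admissible_concat..|exact: addr_ge0|].
by apply: ae_eq_upto_concat; [exact: ae_eq_uptoW|rewrite addrK].
Qed.

Definition glued_strategy x lam (cont : 'rV[R]_n -> strategy) : strategy :=
  fun u => concat T (lam u) (cont (traj f x u (lam u) T) (u \o shift T)).

Lemma glued_strategyP x lam (cont : 'rV[R]_n -> strategy) : nonanticipative lam ->
  (forall y, nonanticipative (cont y)) -> nonanticipative (glued_strategy x lam cont).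
Proof.
move=> [lamD lam_na] scont; split=> [u au|u u' au au' t t0 uu'].
  apply: admissible_concat T0 (lamD _ au) _.
  by apply: (scont _).1; exact: admissible_shift.
have lamt := lam_na _ _ au au' _ t0 uu'.
apply: (ae_eq_upto_concat lamt).
have [Tt|tT] := leP T t; last by apply: ae_eq_upto_lt0; rewrite subr_lt0.
have <- : traj f x u (lam u) T = traj f x u' (lam u') T.
  apply: (eq_traj_upto _ au au' (lamD _ au) (lamD _ au') (ae_eq_uptoS Tt uu')
    (ae_eq_uptoS Tt lamt)).
  by rewrite T0 lexx.
apply: (scont _).2; [exact: admissible_shift..|by rewrite subr_ge0|].
by apply: ae_eq_upto_shift => //; rewrite subrK.
Qed.

Lemma guaranteed_cost_le_truncated x lam u : nonanticipative lam -> admissible U u ->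
  guaranteed_cost U (J x) lam <= JT x u (lam u).
Proof.
move=> slam au; have [lamD lam_na] := slam; set y := traj f x u (lam u) T.
have slamT := shifted_strategyP au slam.
apply: (@le_trans _ _ (truncated_cost gamma l c T (traj f x u (lam u))
    (guaranteed_cost U (J y) (shifted_strategy u lam)))); last first.
  rewrite -[leLHS]subr0; apply: truncated_cost_lerB => //; rewrite subr0.
  exact: (le_upper_value au0 (reach_avoid_cost_norm_le y)).
apply: le_truncated_cost_inf => [|v av]; first by exists u0.
have aw := admissible_concat T0 au av; have wu := ae_eq_upto_concatl T u v.
have restart := @reach_avoid_cost_restart x _ _ v _ _ (shifted_strategy u lam v)
  aw au av (lamD _ aw) (lamD _ au) (slamT.1 _ av) wu (lam_na _ _ aw au _ T0 wu).
rewrite -restart; [|exact: concat_shift|by []].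
exact: guaranteed_cost_le (reach_avoid_cost_norm_le x) aw.
Qed.

Lemma truncated_cost_le_glued x lam (cont : 'rV[R]_n -> strategy) u e :
  0 <= e -> nonanticipative lam -> (forall y, nonanticipative (cont y)) ->
  (forall y, V y - e <= guaranteed_cost U (J y) (cont y)) -> admissible U u ->
  JT x u (lam u) - e <= J x u (glued_strategy x lam cont u).
Proof.
move=> e0 slam scont cont_opt au; have auT := admissible_shift T0 au.
set y := traj f x u (lam u) T.
have restart := @reach_avoid_cost_restart x u u (u \o shift T) _ (lam u)
  (cont y (u \o shift T)) au au auT ((glued_strategyP x slam scont).1 _ au)
  (slam.1 _ au) ((scont y).1 _ auT).
rewrite restart;
  [|exact: ae_eq_uptoW|exact: ae_eq_upto_concatl|by []|exact: concat_shift].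
apply: truncated_cost_lerB => //; apply: le_trans (cont_opt y) _.
exact: guaranteed_cost_le (reach_avoid_cost_norm_le y) auT.
Qed.

Lemma truncated_guaranteed_cost_le_V_gamma x lam : nonanticipative lam ->
  guaranteed_cost U (JT x) lam <= V x.
Proof.
move=> slam; apply/ler_addgt0Pl => e e0.
have /choice[cont contP] y : exists lam',
    nonanticipative lam' /\ V y - e <= guaranteed_cost U (J y) lam'.
  have [lam' slam' /ltW] :=
    upper_value_adherent au0 ad0 (reach_avoid_cost_norm_le y) e0.
  by exists lam'.
have scont y : nonanticipative (cont y) by case: (contP y).
have sglued := glued_strategyP x slam scont.
rewrite -lerBlDl.
apply: le_trans (le_upper_value au0 (reach_avoid_cost_norm_le x) sglued).
apply: (le_guaranteed_cost au0) => u au.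
apply: le_trans (truncated_cost_le_glued x (ltW e0) slam scont
  (fun y => (contP y).2) au).
rewrite lerD2r.
exact: guaranteed_cost_le (truncated_reach_avoid_cost_norm_le x) au.
Qed.

Lemma V_gamma_dynamic_programming x : V x = upper_value U D (JT x).
Proof.
apply/le_anti/andP; split; last first.
  by apply: (upper_value_le ad0) => lam; exact: truncated_guaranteed_cost_le_V_gamma.
rewrite V_gammaE; apply: (upper_value_le ad0) => lam slam.
apply: le_trans (le_upper_value au0 (truncated_reach_avoid_cost_norm_le x) slam).
by apply: (le_guaranteed_cost au0) => u; exact: guaranteed_cost_le_truncated.
Qed.

End reach_avoid_game.

Theorem mainTheorem3 (R : realType) (n mu md : nat)
    (U : set 'rV[R]_mu) (D : set 'rV[R]_md)
    (f : 'rV[R]_n -> 'rV[R]_mu -> 'rV[R]_md -> 'rV[R]_n)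
    (l c : 'rV[R]_n -> R) (gamma : R)
    (hUc : compact U) (hUcv : convex_rV U)
    (hDc : compact D) (hDcv : convex_rV D)
    (hf_uc : forall e : R, 0 < e -> exists2 delta : R, 0 < delta &
       forall x x' u u' d d', U u -> U u' -> D d -> D d' ->
         `|x - x'| < delta -> `|u - u'| < delta -> `|d - d'| < delta ->
         `|f x u d - f x' u' d'| < e)
    (hf_bd : exists M : R, forall x u d, U u -> D d -> `|f x u d| <= M)
    (hf_lip : exists L : R, forall x y u d, U u -> D d ->
       `|f x u d - f y u d| <= L * `|x - y|)
    (hl_bd : exists M : R, forall x, `|l x| <= M)
    (hl_lip : exists L : R, forall x y, `|l x - l y| <= L * `|x - y|)
    (hc_bd : exists M : R, forall x, `|c x| <= M)
    (hc_lip : exists L : R, forall x y, `|c x - c y| <= L * `|x - y|)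
    (hgamma : 0 < gamma) :
  forall (x : 'rV[R]_n) (T : R), 0 < T ->
    V_gamma f U D l c gamma x =
    sup [set inf [set
           (let xi := traj f x u (lam u) in
            Num.min
              (inf [set ra_cost gamma l c xi t | t in `[0, T]])
              (Num.max (expR (- (gamma * T)) * V_gamma f U D l c gamma (xi T))
                       (run_max gamma c xi T)))
         | u in admissible U]
    | lam in nonanticipative_strategy U D].
Proof.
move=> x T T0.
have [[[u0 d0] [au0 ad0]]|none] :=
  pselect (exists p, admissible U p.1 /\ admissible D p.2); last first.
  apply: (@eq_upper_value _ _ _ U D (reach_avoid_cost f l c gamma x)
    (truncated_reach_avoid_cost U D f l c gamma T x)) => u d au ad.
  by case: none; exists (u, d).
have [[M f_bounded] [L f_lipschitz]] := (hf_bd, hf_lip).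
have [[Bl lB] [Bc cB]] := (hl_bd, hc_bd).
apply: (V_gamma_dynamic_programming hf_uc f_bounded f_lipschitz (B := Num.max Bl Bc)
  (ltW hgamma) _ _ au0 ad0 (ltW T0)) => y.
- by rewrite le_max lB.
- by rewrite le_max cB orbT.
Qed.
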